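(* Let $G$ be a split graph with vertex partition $\{X,Y\}$, where $X=\{v_1,\ldots,v_n\}$ is a maximal clique of $G$ and $Y=V(G)\setminus X$ is a stable set, and write $d_i=|N_G(v_i)\cap Y|$ for $1\le i\le n$, with the vertices labelled so that $d_1\ge d_2\ge\cdots\ge d_n$. If $n\ge 10$, then: (i) $\chi'_{\rm irr}(G)\le 2$ if and only if $d_1\ge\lfloor n/2\rfloor$ or $d_2\ge 1$; (ii) $\chi'_{\rm irr}(G)=3$ if and only if $d_1<\lfloor n/2\rfloor$ and $d_2=0$.
   Context: All graphs are finite and simple. A graph is locally irregular if any two adjacent vertices have distinct degrees. A decomposition of $G$ is a collection of subgraphs whose edge sets partition $E(G)$; a locally irregular decomposition is one in which every subgraph is locally irregular. $G$ is decomposable if it admits a locally irregular decomposition, and for decomposable $G$ the irregular chromatic index $\chi'_{\rm irr}(G)$ is the minimum number of subgraphs in a locally irregular decomposition of $G$ (equivalently, the minimum number of colors in an edge coloring in which each color class induces a locally irregular graph). A split graph is a graph whose vertex set can be partitioned into a clique and a stable set. *)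

(* Defs.v *)
From mathcomp Require Import all_boot.
Set Implicit Arguments. Unset Strict Implicit. Unset Printing Implicit Defensive.

Section Graphs.
Variable T : finType.
(* A simple graph on T is a symmetric irreflexive relation e. *)
Variable e : rel T.

Definition is_clique (K : {set T}) : Prop :=
  forall x y, x \in K -> y \in K -> x != y -> e x y.

Definition is_stable (S : {set T}) : Prop :=
  forall x y, x \in S -> y \in S -> ~~ e x y.

Definition is_maximal_clique (K : {set T}) : Prop :=
  is_clique K /\ forall K' : {set T}, is_clique K' -> K \subset K' -> K' = K.

(* Edge colouring with k colours: c x y is the colour of the edge xy;
   it must be well defined on (unordered) edges. *)
Definition edge_colouring k (c : T -> T -> 'I_k) : Prop :=
  forall x y, e x y -> c x y = c y x.

Definition col_deg k (c : T -> T -> 'I_k) (i : 'I_k) (x : T) : nat :=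
  #|[set y | e x y && (c x y == i)]|.

Definition locally_irregular_colouring k (c : T -> T -> 'I_k) : Prop :=
  edge_colouring c /\
  forall x y, e x y -> col_deg c (c x y) x != col_deg c (c x y) y.

Definition irr_colourable (k : nat) : Prop :=
  exists c : T -> T -> 'I_k, locally_irregular_colouring c.

Definition decomposable : Prop := exists k, irr_colourable k.

Definition is_chi_irr (k : nat) : Prop :=
  irr_colourable k /\ forall j, irr_colourable j -> k <= j.

End Graphs.

Definition dY (T : finType) (e : rel T) (X : {set T}) (x : T) : nat :=
  #|[set y | e x y] :&: ~: X|.

(* Main.v *)
(* Lower bound: if only v_1 has Y-neighbours, the red degrees of v_2, ..., v_n are
   distinct and take the values 0, ..., n-2 (up to exchanging the colours).  The
   degrees then meet the Erdos-Gallai bound with equality, so v_1 has exactly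
   ceil(n/2) - 1 red neighbours in X, and with fewer than n/2 pendant edges its red
   or blue degree coincides with that of a neighbour of that colour.

   Upper bound: split X into a red half and a blue half joined by a half graph, and
   give the Y-edges the colour of the half they start from.  Only the two middle
   vertices have equal degrees inside X; they can be separated as soon as the sum of
   the d_i is at least n/2, by ordering the red half so that the Y-degrees shift its
   red degrees to distinct values.  If the sum is smaller but d_2 > 0, then v_1 and
   v_2 are kept outside the two halves and attached so that the other red degrees
   inside X become 1, ..., n-2 (0, ..., n-3 for odd n); this needs n >= 10. *)
Require Import Defs.
From mathcomp Require Import all_boot.
From mathcomp Require Import zify.

Set Implicit Arguments.
Unset Strict Implicit.
Unset Printing Implicit Defensive.

(** * Indicator sums and degrees inside the clique *)

Lemma sum_interval n a b : \sum_(i < n) (a <= i < b : nat) = minn b n - a.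
Proof.
elim: n => [|n IH]; first by rewrite big_ord0; lia.
by rewrite big_ord_recr /= IH; lia.
Qed.

Lemma sum_pred1 n c : \sum_(i < n) (val i == c : nat) = (c < n).
Proof.
elim: n => [|n IH]; first by rewrite big_ord0.
by rewrite big_ord_recr /= IH; lia.
Qed.

(** The degree of [a] inside the clique in the colour given by [R]. The diagonal is skipped, so
    negating [R] exchanges the two colours. *)
Definition row_sum n (R : rel nat) a := \sum_(b < n) ((val b != a) && R a b : nat).

Lemma row_sum_compl n (R : rel nat) a : a < n ->
  row_sum n (fun x y => ~~ R x y) a = n.-1 - row_sum n R a.
Proof.
move=> an; suff: row_sum n (fun x y => ~~ R x y) a + row_sum n R a + 1 = n by lia.
have <- : \sum_(b < n) (val b == a : nat) = 1 by rewrite sum_pred1 an.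
rewrite -!big_split /= -[RHS]card_ord -sum1_card.
by apply: eq_bigr => i _; case: (val i == a); case: (R a i).
Qed.

Lemma row_sum_lt n (R : rel nat) a : a < n -> row_sum n R a < n.
Proof.
move=> an; suff: row_sum n R a + 1 <= n by lia.
have <- : \sum_(b < n) (val b == a : nat) = 1 by rewrite sum_pred1 an.
rewrite -!big_split /= -[X in _ <= X]card_ord -sum1_card.
by apply: leq_sum => i _; case: (val i == a); case: (R a i).
Qed.

Lemma irr_colourable_leq (T : finType) (e : rel T) j k :
  j <= k -> irr_colourable e j -> irr_colourable e k.
Proof.
move=> jk [c [csym cirr]]; exists (fun x y => widen_ord jk (c x y)); split.
  by move=> x y /csym ->.
by move=> x y xy; apply: cirr.
Qed.

(** * Obstruction to two colours *)

Lemma double_sum_id n : (\sum_(i < n) i).*2 = n * n.-1.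
Proof.
elim: n => [|n IH]; first by rewrite big_ord0.
by rewrite big_ord_recr /= doubleD IH; case: n {IH} => //= n; lia.
Qed.

(* Only row 0 may repeat a value, so the other rows are a permutation of
   [0..m-1]; the h smallest against the others is then an equality case
   of the Erdos-Gallai inequality, which determines row 0. *)
Lemma distinct_rows_row0 m (R : rel nat) (h := m.+1./2) : 0 < m ->
  (forall a b, a < m.+1 -> b < m.+1 -> a != b -> R a b = R b a) ->
  (forall a b, 0 < a < b -> b < m.+1 -> row_sum m.+1 R a != row_sum m.+1 R b) ->
  (forall a, 0 < a < m.+1 -> row_sum m.+1 R a < m) ->
  [/\ row_sum m.+1 R 0 = m - h,
      forall k, k < m -> exists2 a, 0 < a < m.+1 & row_sum m.+1 R a = k &
      forall a, 0 < a < m.+1 -> R 0 a = (h <= row_sum m.+1 R a)].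
Proof.
move=> m0 Rsym Rdist Rlt.
pose r (a : 'I_m) := row_sum m.+1 R a.+1.
have rlt a : r a < m by apply: Rlt; have := ltn_ord a; lia.
pose s a := Ordinal (rlt a).
have s_inj : injective s.
  move=> a b [] rab; apply: val_inj; have an := ltn_ord a; have bn := ltn_ord b.
  case: (ltngtP a b) => // ab.
    by have /eqP := Rdist a.+1 b.+1 ab bn.
  by have /eqP := Rdist b.+1 a.+1 ab an; rewrite -/(r b) -/(r a) rab.
have onto k : k < m -> exists2 a, 0 < a < m.+1 & row_sum m.+1 R a = k.
  move=> km; pose a := invF s_inj (Ordinal km); exists a.+1; first exact: (ltn_ord a).
  by have /(congr1 val) := f_invF s_inj (Ordinal km).
pose z (a : 'I_m) : nat := R 0 a.+1.
pose g (a b : 'I_m) : nat := (b != a) && R a.+1 b.+1.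
pose P (a : 'I_m) := h <= r a.
have rE a : r a = z a + \sum_b g a b.
  rewrite /r /row_sum big_ord_recl /=; congr (_ + _).
  by rewrite /z Rsym // ltnS ltn_ord.
have gsym a b : g a b = g b a.
  rewrite /g; have [//|ba] := eqVneq b a.
  by rewrite /= Rsym ?ltnS // eqSS eq_sym.
have splitg Q : \sum_(a | Q a) r a = \sum_(a | Q a) z a +
    (\sum_(a | Q a) \sum_(b | P b) g a b + \sum_(a | Q a) \sum_(b | ~~ P b) g a b).
  rewrite -!big_split /=; apply: eq_bigr => a _.
  by rewrite rE (bigID P).
have cross : \sum_(a | P a) \sum_(b | ~~ P b) g a b = \sum_(a | ~~ P a) \sum_(b | P b) g a b.
  rewrite exchange_big /=; apply: eq_bigr => a _; apply: eq_bigr => b _; exact: gsym.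
have hm : h <= m by rewrite /h; lia.
have cardP : \sum_(a | P a) 1 = m - h.
  rewrite -(reindex_inj s_inj (P := fun k : 'I_m => h <= k) (F := fun=> 1)) big_mkcond /=.
  transitivity (\sum_(k < m) (h <= k < m : nat)); last by rewrite sum_interval; lia.
  by apply: eq_bigr => k _; rewrite ltn_ord andbT; case: ifP.
have sumlow : \sum_(a | ~~ P a) r a = \sum_(k < h) k.
  rewrite -(reindex_inj s_inj (P := fun k : 'I_m => ~~ (h <= k)) (F := @nat_of_ord m)) /=.
  rewrite (big_ord_widen m id hm); apply: eq_bigl => k; lia.
have sumall : \sum_a r a = \sum_(k < m) k.
  by rewrite -(reindex_inj s_inj (P := predT) (F := @nat_of_ord m)).
have inner : \sum_(a | P a) \sum_(b | P b) g a b + (m - h) <= (m - h) * (m - h).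
  have -> : (m - h) * (m - h) = \sum_(a | P a) (m - h).
    by rewrite -{1}cardP big_distrl; apply: eq_bigr => a _; rewrite /= ?mul1n.
  rewrite -{1}cardP -big_split /=; apply: leq_sum => a Pa.
  rewrite -cardP (bigD1 a) //= [X in _ <= X](bigD1 a) //=.
  rewrite {1}/g eqxx /= add0n addnC leq_add2l; apply: leq_sum => b _.
  by rewrite /g; case: (_ && _).
have zP : \sum_(a | P a) z a <= m - h.
  by rewrite -cardP; apply: leq_sum => a _; rewrite /z; case: (R _ _).
have Dm := double_sum_id m; have Dh := double_sum_id h.
(* By the choice of [h], the values from [h] on sum to [(m - h)^2] plus the sum of the values below
   [h]. *)
have key : (\sum_(k < m) k) = (m - h) * (m - h) + (\sum_(k < h) k).*2.
  have [k [hk mk]] : exists k, h = k.+1 /\ (m = k.*2.+1 \/ m = k.+1.*2).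
    by exists h.-1; rewrite /h; lia.
  move: Dm Dh; rewrite hk; case: mk => ->; rewrite /= -!muln2; nia.
(* The large rows receive at most [m - h] from row 0, [(m - h)^2 - (m - h)] from each other, and the
   sum of the small rows across. The total equals this bound, so every estimate is tight. *)
have [zP1 zP0] : \sum_(a | P a) z a = m - h /\ \sum_(a | ~~ P a) z a = 0.
  move: sumall; rewrite (bigID P) /= sumlow splitg cross.
  move: sumlow; rewrite splitg key. move: inner zP.
  move: (\sum_(a | P a) z a) (\sum_(a | ~~ P a) z a) (\sum_(a | P a) \sum_(b | P b) g a b)
    (\sum_(a | ~~ P a) \sum_(b | P b) g a b) => *; lia.
have row0 : row_sum m.+1 R 0 = m - h.
  rewrite /row_sum big_ord_recl /= add0n; transitivity (\sum_a z a); first exact: eq_bigr.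
  by rewrite (bigID P) /= zP1 zP0 addn0.
split=> // a /andP [a0 am]; have am1 : a.-1 < m by lia.
have Ea : a = (Ordinal am1).+1 by rewrite /=; lia.
rewrite {1 2}Ea -/(r _) -/(P _).
have [Pa|Pa] := boolP (P (Ordinal am1)).
  apply/negPn/negP => nz; have : \sum_(a | P a) z a < \sum_(a | P a) 1.
    rewrite (bigD1 (Ordinal am1)) //= [X in _ < X](bigD1 (Ordinal am1)) //=.
    rewrite /z (negPf nz) add0n add1n ltnS; apply: leq_sum => b _; by case: (R _ _).
  by rewrite zP1 cardP ltnn.
by apply/eqP; move/eqP: zP0; rewrite sum_nat_eq0 => /forallP /(_ (Ordinal am1));
  rewrite Pa /z; case: (R _ _).
Qed.

(** Vertex 0 has red degree [m - h + p]. If this is at least [h], some red neighbour has it too, as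
    red neighbours realise all of [h], ..., [m - 1]. Otherwise its blue degree [h + q] is that of a
    blue neighbour. *)
Lemma no_two_colouring_lt m (R : rel nat) p q (h := m.+1./2) : 0 < m ->
  (forall a b, a < m.+1 -> b < m.+1 -> a != b -> R a b = R b a) ->
  (forall a b, 0 < a < b -> b < m.+1 -> row_sum m.+1 R a != row_sum m.+1 R b) ->
  (forall a, 0 < a < m.+1 -> R 0 a -> row_sum m.+1 R 0 + p != row_sum m.+1 R a) ->
  (forall a, 0 < a < m.+1 -> ~~ R 0 a ->
     m - row_sum m.+1 R 0 + q != m - row_sum m.+1 R a) ->
  p + q < h ->
  (forall a, 0 < a < m.+1 -> row_sum m.+1 R a < m) -> False.
Proof.
move=> m0 Rsym Rdist Rred Rblue pq Rlt.
have [r0 onto R0] := distinct_rows_row0 m0 Rsym Rdist Rlt.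
have [hp|hp] := leqP h (m - h + p).
  have [|a am ra] := onto (m - h + p); first by rewrite /h in hp pq *; lia.
  by have := Rred a am; rewrite R0 // r0 ra hp eqxx => /(_ isT).
(* Here [m] is odd and [p = 0], so [m = h.*2 - 1], and red degree [h - 1 - q] means blue degree
   [h + q]. *)
have [|a am ra] := onto (h - 1 - q); first by rewrite /h in hp pq *; lia.
have := Rblue a am; rewrite R0 // r0 ra.
have -> : (h <= h - 1 - q) = false by lia.
by move=> /(_ isT); rewrite /h in hp pq *; lia.
Qed.

Lemma no_two_colouring m (R : rel nat) p q : 0 < m ->
  (forall a b, a < m.+1 -> b < m.+1 -> a != b -> R a b = R b a) ->
  (forall a b, 0 < a < b -> b < m.+1 -> row_sum m.+1 R a != row_sum m.+1 R b) ->
  (forall a, 0 < a < m.+1 -> R 0 a -> row_sum m.+1 R 0 + p != row_sum m.+1 R a) ->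
  (forall a, 0 < a < m.+1 -> ~~ R 0 a ->
     m - row_sum m.+1 R 0 + q != m - row_sum m.+1 R a) ->
  p + q < m.+1./2 -> False.
Proof.
move=> m0 Rsym Rdist Rred Rblue pq.
have rlt a : a < m.+1 -> row_sum m.+1 R a < m.+1 by apply: row_sum_lt.
have compl a : a < m.+1 -> row_sum m.+1 (fun x y => ~~ R x y) a = m - row_sum m.+1 R a.
  exact: row_sum_compl.
(* A row [b] equal to [m] is red towards every other vertex. No row is then 0, and the colours can
   be exchanged together with [p] and [q]. *)
have [/existsP [b /andP [b0 /eqP bm]]|] :=
    boolP [exists b : 'I_m.+1, (0 < b) && (row_sum m.+1 R b == m)]; last first.
  move=> /existsPn full; apply: (no_two_colouring_lt m0 Rsym Rdist Rred Rblue pq).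
  move=> a /andP [a0 am]; have := full (Ordinal am); rewrite a0 /=.
  by have := rlt a am; lia.
apply: (@no_two_colouring_lt m (fun x y => ~~ R x y) q p m0).
- by move=> x y xm ym xy; rewrite Rsym.
- move=> x y xy ym; rewrite !compl; try lia.
  by have := Rdist x y xy ym; have := rlt x; have := rlt y; lia.
- by move=> a am; rewrite !compl; try lia; apply: Rblue.
- move=> a /andP [a0 am]; rewrite !compl // negbK => Ra.
  by have := Rred a _ Ra; rewrite a0 am => /(_ isT); have := rlt a am; have := rlt 0 isT; lia.
- by rewrite addnC.
- move=> a /andP [a0 am]; rewrite compl //.
  suff : 0 < row_sum m.+1 R a by lia.
  have [-> |ab] := eqVneq a b; first by rewrite bm.
  have Rba : R b a.
    apply/negPn/negP => nR; have := row_sum_compl R (ltn_ord b); rewrite bm /= subnn.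
    move/eqP; rewrite sum_nat_eq0 => /forallP /(_ (Ordinal am)) /=.
    by rewrite nR ab.
  rewrite /row_sum (bigD1 b) //= Rsym // ?ltn_ord // Rba.
  by rewrite eq_sym ab.
Qed.

(** * Two-colourings *)

(* Vertices 0 and 1 have [dt] and [ds] Y-neighbours, joined by blue and red edges.
   The other vertices form a half graph.  Vertex 1 has red degree [p + ds] and avoids
   [p + 2 - ds], which has the same red degree; it takes [p + 2], which has its blue
   degree.  Vertex 0 has red degree 4 and takes [c], which has its blue degree; for
   [dt > 2] its blue degree exceeds all others with red degree 2, and [c] is not
   needed.  Deleting the edges [3, p + 2] and [2, c] compensates for [p + 2] and [c]. *)
Definition sparse_red p ds dt a b : bool :=
  let c := p.*2 - 2 + dt in
  [|| (a == 0) && [|| b == p + 2 - ds, b == 3 | (dt <= 2) && ((b == 2) || (b == c))],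
      [&& a == 1, 2 <= b <= p + 2 & b != p + 2 - ds] |
      [&& 2 <= a, a + b <= p.*2 + 3, ~~ ((a == 3) && (b == p + 2)) &
          ~~ [&& dt <= 2, a == 2 & b == c]]].

Definition sparse_row p dt a :=
  if a == 0 then if dt <= 2 then 4 else 2 else if a == 1 then p else p.*2 + 2 - a.

Lemma sum_pred1M n c k : \sum_(i < n) k * (val i == c) = k * (c < n).
Proof. by rewrite -big_distrr sum_pred1. Qed.

Lemma nat_of_andNN (k x y : bool) : (x -> k) -> (y -> k) -> (x -> ~~ y) ->
  [&& k, ~~ x & ~~ y] + (x + y) = k.
Proof. by case: k x y => [] [] [] //= A B C; exfalso; move: A B C; lia. Qed.

Section SparseRow.
Variables n p ds dt : nat.
Hypotheses (hn : p.+1.*2 <= n <= p.+1.*2.+1) (p4 : 4 <= p).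
Hypotheses (hds : 0 < ds <= dt) (hdt : ds + dt <= p).
Let s := p + 2 - ds.
Let c := p.*2 - 2 + dt.
Let small := dt <= 2.

Lemma sparse_red0 b : sparse_red p ds dt 0 b =
  (b == s) + (b == 3) + small * (b == 2) + small * (b == c) :> nat.
Proof.
rewrite /sparse_red -/c -/s -/small /=.
case: (eqVneq b s) => /=; first by rewrite /s /small /c; lia.
case: (eqVneq b 3) => /=; first by rewrite /s /small /c; lia.
case: (eqVneq b 2) => /=; first by rewrite /s /small /c; lia.
by case: small; case: (b == c).
Qed.

Lemma sparse_red1 b : sparse_red p ds dt 1 b + (b == s) = (2 <= b <= p + 2).
Proof. by rewrite /sparse_red -/s /= orbF; case: eqVneq => /= => [->|]; rewrite /s; lia. Qed.

Lemma sparse_red2 a b : 2 <= a < b ->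
  sparse_red p ds dt a b + (((a == 3) && (b == p + 2)) + [&& small, a == 2 & b == c])
  = (a + b <= p.*2 + 3).
Proof.
move=> /andP [a2 _]; rewrite -(@nat_of_andNN (a + b <= p.*2 + 3)
  ((a == 3) && (b == p + 2)) [&& small, a == 2 & b == c]); last first.
- by move=> /andP [/eqP -> _]; rewrite andbF.
- by rewrite /small /c; lia.
- by lia.
by move: a2; rewrite /sparse_red; case: a => [|[|a]].
Qed.

(** From vertex 2 on, [a + b <= p.*2 + 3] also counts [b = a] when [a <= p + 1], which costs these
    rows one. Vertices 0 and 1 together give one back to each of 2, ..., [p + 2]. Deleting the edge
    from 3 to [p + 2] cancels the excess at [p + 2] and the edge from 0 to 3; deleting the one from
    2 to [c] cancels the edges from 0 to 2 and [c]. *)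
Lemma row_sum_sparse a : a < n ->
  row_sum n (fun a b => sparse_red p ds dt (minn a b) (maxn a b)) a = sparse_row p dt a.
Proof.
move=> an; rewrite /row_sum /sparse_row.
have hs : 4 <= s <= p + 1 by rewrite /s; lia.
have hc : p + 3 <= c by rewrite /c; lia.
have hc2 : small -> c <= p.*2 by rewrite /c /small; lia.
have [a0|a0] := eqVneq a 0.
  subst a.
  transitivity (\sum_(b < n) ((val b == s) + (val b == 3) +
     small * (val b == 2) + small * (val b == c))).
    apply: eq_bigr => b _; rewrite min0n max0n -sparse_red0.
    by case: eqVneq => [/= ->|//]; rewrite sparse_red0; lia.
  by rewrite !big_split /= !sum_pred1M !sum_pred1; case: ifP hc2; lia.
have [a1|a1] := eqVneq a 1.
  subst a.
  have : \sum_(b < n) ((val b != 1) && sparse_red p ds dt (minn 1 b) (maxn 1 b) : nat)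
       + \sum_(b < n) (val b == s) = \sum_(b < n) (2 <= b < p + 3).
    rewrite -big_split /=; apply: eq_bigr => b _.
    case: (posnP b) => [->|b0].
      by rewrite minn0 maxn0; have := sparse_red0 1; lia.
    rewrite (minn_idPl b0) (maxn_idPr b0).
    by have := sparse_red1 b; case: eqVneq => [->|_] /=; lia.
  by rewrite sum_pred1 sum_interval; lia.
(* Corrections are only added, to avoid truncated subtraction: on the left the diagonal and both
   ends of each deleted edge, on the right columns 0 and 1. *)
have : \sum_(b < n) ((val b != a) && sparse_red p ds dt (minn a b) (maxn a b) : nat)
     + \sum_(b < n) ((a <= p + 1) * (val b == a) + (a == 3) * (val b == p + 2)
       + (a == p + 2) * (val b == 3) + (small && (a == 2)) * (val b == c)
       + (small && (a == c)) * (val b == 2))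
     = \sum_(b < n) (2 <= b < p.*2 + 4 - a) +
       \sum_(b < n) (sparse_red p ds dt 0 a * (val b == 0)
        + sparse_red p ds dt 1 a * (val b == 1)).
  rewrite -!big_split /=; apply: eq_bigr => b _; rewrite !mulnb.
  have [->|b0] := eqVneq (val b) 0.
    rewrite minn0 maxn0 (eq_sym 0 a) (negPf a0) /= !andbF andbT.
    have -> : (0 == p + 2) = false by lia.
    have -> : (0 == c) = false by lia.
    by rewrite !andbF /= ?addn0 ?add0n.
  have [->|b1] := eqVneq (val b) 1.
    have -> : minn a 1 = 1 by lia.
    have -> : maxn a 1 = a by lia.
    rewrite (eq_sym 1 a) (negPf a1) /= !andbF andbT.
    have -> : (1 == p + 2) = false by lia.
    have -> : (1 == c) = false by lia.
    by rewrite !andbF /= ?addn0 ?add0n.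
  have [a2 b2] : 2 <= a /\ 2 <= b by move: b0 b1 => /=; lia.
  case: (ltngtP a b) => ab /=; rewrite ?andbF ?andbT ?addn0 ?add0n.
  - have -> : (a == p + 2) && (b == 3 :> nat) = false by lia.
    have -> : small && (a == c) && (b == 2 :> nat) = false by lia.
    have := sparse_red2 (a := a) (b := b); rewrite a2 ab andbA => /(_ isT). lia.
  - have -> : (a == 3) && (b == p + 2 :> nat) = false by lia.
    have -> : small && (a == 2) && (b == c :> nat) = false by lia.
    have := sparse_red2 (a := b) (b := a); rewrite b2 ab andbA => /(_ isT).
    rewrite [(b == 3 :> nat) && _]andbC -!andbA [(b == 2 :> nat) && _]andbC. lia.
  - have -> : (a == 3) && (b == p + 2 :> nat) = false by lia.
    have -> : (a == p + 2) && (b == 3 :> nat) = false by lia.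
    have -> : small && (a == 2) && (b == c :> nat) = false by lia.
    have -> : small && (a == c) && (b == 2 :> nat) = false by lia.
    by rewrite /=; lia.
rewrite !big_split /= !sum_pred1M sum_interval.
have := sparse_red0 a; have := sparse_red1 a.
have -> : p + 2 < n by lia.
have -> : 3 < n by lia.
have -> : 2 < n by lia.
have -> : 1 < n by lia.
have -> : 0 < n by lia.
rewrite an !muln1.
have -> : (small && (a == 2)) * (c < n) = small * (a == 2).
  case: (boolP small) => [/hc2 cp|_] //; have -> : c < n by lia.
  by rewrite muln1 mul1n.
have -> : (small && (a == c) : nat) = small * (a == c) by rewrite mulnb.
have -> : minn (p.*2 + 4 - a) n = p.*2 + 4 - a by lia.
have sa : (a == s) = false \/ a <= p + 1 by case: eqVneq => [->|_]; [right; lia | left].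
move: (small * (a == 2)) (small * (a == c)) (nat_of_bool (sparse_red p ds dt 0 a))
  (nat_of_bool (sparse_red p ds dt 1 a)) => x y z t.
move: (\sum_(b < n) _) => S.
clear hc2; clearbody small s c.
by lia.
Qed.
End SparseRow.

(** * Two-colourings of a split graph from a red relation on its clique *)

Section Split.
Variables (T : finType) (e : rel T) (X : {set T}) (n : nat) (v : nat -> T).
Hypotheses (e_sym : symmetric e) (e_irr : irreflexive e).
Hypotheses (hK : is_clique e X) (hY : is_stable e (~: X)).
Hypothesis v_inj : {in [pred i | i < n] &, injective v}.
Hypothesis hX : X = [set v (val i) | i : 'I_n].

Let d i := dY e X (v i).

Lemma v_eq i j : i < n -> j < n -> (v i == v j) = (i == j).
Proof. by move=> ni nj; apply/eqP/eqP => [|-> //]; apply: v_inj. Qed.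

Lemma v_in i : i < n -> v i \in X.
Proof. by move=> ni; rewrite hX; apply/imsetP; exists (Ordinal ni). Qed.

Lemma in_vP x : x \in X -> exists2 i, i < n & x = v i.
Proof. by rewrite hX => /imsetP [i _ ->]; exists i. Qed.

Lemma v_adj i j : i < n -> j < n -> e (v i) (v j) = (i != j).
Proof.
move=> ni nj; have [->|ij] := eqVneq i j; first by rewrite e_irr.
by apply: hK; rewrite ?v_in // v_eq.
Qed.

Lemma card_inX (P : pred T) : #|[set y | P y] :&: X| = \sum_(i < n) (P (v i) : nat).
Proof.
rewrite -sum1_card big_mkcond /=.
transitivity (\sum_(y in X) (P y : nat)).
  rewrite [RHS]big_mkcond; apply: eq_bigr => y _; rewrite !inE.
  by case: (y \in X); case: (P y).
rewrite hX big_imset //= => i j _ _ vij; apply: val_inj; by apply: v_inj vij; rewrite inE ltn_ord.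
Qed.

Lemma col_deg_inX k (c : T -> T -> 'I_k) i a : a < n ->
  col_deg e c i (v a) = row_sum n (fun x y => c (v x) (v y) == i) a +
    #|[set y | e (v a) y && (c (v a) y == i)] :\: X|.
Proof.
move=> an; rewrite /col_deg -(cardsID X) card_inX; congr (_ + _).
by apply: eq_bigr => b _; rewrite v_adj // eq_sym.
Qed.

(** All Y-edges at [v a] share one colour, red if [B a], so the Y-degree of [v a] counts in that
    colour only. Red is [ord0]. *)
Lemma two_colourable (R : rel nat) (B : pred nat) (r : nat -> nat) :
  (forall a b, R a b = R b a) ->
  (forall a, a < n -> row_sum n R a = r a) ->
  (forall a b, a < b -> b < n -> R a b -> r a + B a * d a != r b + B b * d b) ->
  (forall a b, a < b -> b < n -> ~~ R a b ->
     n.-1 - r a + ~~ B a * d a != n.-1 - r b + ~~ B b * d b) ->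
  (forall a y, a < n -> y \notin X -> e (v a) y ->
     \sum_(b < n) (e (v b) y && (B b == B a) : nat) !=
       if B a then r a + d a else n.-1 - r a + d a) ->
  irr_colourable e 2.
Proof.
move=> Rsym Rr Hred Hblue HY.
pose idx x := index x [seq v i | i <- iota 0 n].
have idxv i : i < n -> idx (v i) = i.
  move=> ni; have vi : v i = nth (v 0) [seq v i | i <- iota 0 n] i.
    by rewrite (nth_map 0) ?size_iota // nth_iota.
  rewrite /idx {1}vi index_uniq ?size_map ?size_iota // map_inj_in_uniq ?iota_uniq //.
  by move=> j k; rewrite !mem_iota => ? ? /v_inj; apply.
pose red x y := if x \in X then (if y \in X then R (idx x) (idx y) else B (idx x))
  else B (idx y).
pose c x y : 'I_2 := if red x y then ord0 else ord_max.
have cE x y (b : bool) : (c x y == (if b then ord0 else ord_max)) = (red x y == b).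
  by rewrite /c; case: (red x y); case: b.
have red_in a b : a < n -> b < n -> red (v a) (v b) = R a b.
  by move=> an bn; rewrite /red !v_in // !idxv.
have red_out a y : a < n -> y \notin X -> red (v a) y = B a.
  by move=> an yX; rewrite /red v_in // (negPf yX) idxv.
have red_out' a y : a < n -> y \notin X -> red y (v a) = B a.
  by move=> an yX; rewrite /red (negPf yX) idxv.
have degX a (i : bool) : a < n -> col_deg e c (if i then ord0 else ord_max) (v a) =
    if i then r a + B a * d a else n.-1 - r a + ~~ B a * d a.
  move=> an; rewrite col_deg_inX //.
  have -> : #|[set y | e (v a) y && (c (v a) y == if i then ord0 else ord_max)] :\: X|
      = (B a == i) * d a.
    have [E|E] := boolP (B a == i).
      rewrite mul1n /d /dY; apply: eq_card => y; rewrite !inE cE.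
      by have [//|yX] := boolP (y \in X); rewrite ?andbF // red_out // E !andbT.
    rewrite mul0n; apply: eq_card0 => y; rewrite !inE cE.
    by have [//|yX] := boolP (y \in X); rewrite red_out // (negPf E) andbF.
  rewrite -Rr // -row_sum_compl //.
  by case: i; congr (_ + _ * _); rewrite ?eqb_id ?eqbF_neg //;
    apply: eq_bigr => b _; rewrite ?(cE _ _ true) ?(cE _ _ false) red_in ?eqb_id ?eqbF_neg.
have degY y (i : bool) : y \notin X -> col_deg e c (if i then ord0 else ord_max) y =
    \sum_(b < n) (e (v b) y && (B b == i) : nat).
  move=> yX; rewrite /col_deg -(cardsID X) card_inX.
  rewrite [X in _ + X](_ : _ = 0) ?addn0.
    by apply: eq_bigr => b _; rewrite cE red_out' // e_sym.
  apply: eq_card0 => z; rewrite !inE; apply/negP => /andP [zX /andP [yz _]].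
  by have := hY (x := y) (y := z); rewrite !inE yz => /(_ yX zX).
exists c; split.
  move=> x y xy; rewrite /c; congr (if _ then _ else _); rewrite /red.
  have [xX|xX] := boolP (x \in X); have [yX|yX] := boolP (y \in X) => //.
  by have := hY (x := x) (y := y); rewrite !inE xy => /(_ xX yX).
have mixed a y : a < n -> y \notin X -> e (v a) y ->
    col_deg e c (c (v a) y) (v a) != col_deg e c (c (v a) y) y.
  move=> an yX ay; have := HY a y an yX ay.
  rewrite {1 2}/c red_out // degX // degY // eq_sym.
  by rewrite red_out //; case: (B a); rewrite ?mul1n.
have inner a b : a < b -> b < n ->
    col_deg e c (c (v a) (v b)) (v a) != col_deg e c (c (v a) (v b)) (v b).
  move=> ab bn; have an := ltn_trans ab bn.
  have -> : c (v a) (v b) = if R a b then ord0 else ord_max by rewrite /c red_in.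
  rewrite !degX //.
  by have [Rab|Rab] := boolP (R a b); [apply: Hred | apply: Hblue].
move=> x y xy.
have csym : c x y = c y x.
  rewrite /c; congr (if _ then _ else _); rewrite /red.
  have [xX|xX] := boolP (x \in X); have [yX|yX] := boolP (y \in X) => //.
  by have := hY (x := x) (y := y); rewrite !inE xy => /(_ xX yX).
have [/in_vP [a an ax]|xX] := boolP (x \in X); have [/in_vP [b bn bY]|yX] := boolP (y \in X).
- move: xy csym; rewrite {x}ax {y}bY v_adj // => ab csym.
  case: (ltngtP a b) ab => // ab _; first exact: inner.
  by rewrite eq_sym csym; apply: inner.
- by move: xy; rewrite ax; apply: mixed.
- by rewrite eq_sym csym bY; apply: mixed; rewrite // e_sym -bY.
- by have := hY (x := x) (y := y); rewrite !inE xy => /(_ xX yX).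
Qed.

Lemma dY_gt0 x y : y \notin X -> e x y -> 0 < dY e X x.
Proof. by move=> yX xy; apply/card_gt0P; exists y; rewrite !inE xy. Qed.

Lemma dY1_uniq x y z : y \notin X -> z \notin X -> dY e X x <= 1 -> e x y -> e x z -> y = z.
Proof.
move=> yX zX /card_le1P x1 xy xz.
by have := x1 y _ z; rewrite !inE xy xz yX zX => /(_ isT) /esym /eqP.
Qed.

Lemma row_sum_threshold m a : m.*2 <= n -> a < n ->
  row_sum n (fun a b => a + b < m.*2) a = if a < m then m.*2.-1 - a else m.*2 - a.
Proof.
move=> mn an.
have : row_sum n (fun a b => a + b < m.*2) a + \sum_(b < n) (a < m) * (val b == a)
     = \sum_(b < n) (0 <= b < m.*2 - a).
  by rewrite -big_split /=; apply: eq_bigr => b _ /=; lia.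
by rewrite -big_distrr sum_pred1 sum_interval an /=; case: ifP; lia.
Qed.

(* Vertices before position h form a red clique and the others a blue clique,
   joined by a half graph; the two middle vertices, which have the same red
   degree inside X, are separated by the Y-neighbours of [v h.-1]. *)
Lemma halfgraph_colourable h : h.*2 <= n <= h.*2.+1 -> 1 < h ->
  (forall a b, a < b < h -> d a + b != d b + a) ->
  0 < d h.-1 ->
  (forall a b, h <= a < b -> b < n -> a + d a != b + d b) ->
  (forall y, y \notin X -> e (v h) y -> d h <= 1 ->
     exists2 b, h <= b < n & ~~ e (v b) y) ->
  irr_colourable e 2.
Proof.
move=> hn h1 dH dh dL dy.
pose r a := if a < h then h.*2.-1 - a else h.*2 - a.
apply: (two_colourable (R := fun a b => a + b < h.*2) (B := fun a => a < h) (r := r)).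
- by move=> a b; rewrite addnC.
- by move=> a an; apply: row_sum_threshold => //; lia.
- move=> a b ab bn R; rewrite -/(d a) -/(d b) /r.
  have ah : a < h by lia.
  have dah : a = h.-1 -> 0 < d a by move=> ->.
  rewrite ah; case: (ltnP b h) => bh; last lia.
  by have := dH a b; lia.
- move=> a b ab bn R; rewrite -/(d a) -/(d b) /r.
  case: (ltnP b h) => bh; first lia.
  case: (ltnP a h) => ah; first lia.
  by have := dL a b; lia.
- move=> a y an yX ay; rewrite -/(d a) /r.
  have da : 0 < d a := dY_gt0 yX ay.
  case: (ltnP a h) => ah.
    have : \sum_(b < n) (e (v b) y && ((b < h) == true)) <= \sum_(b < n) (0 <= b < h).
      by apply: leq_sum => b _; lia.
    by rewrite sum_interval; lia.
  have le : \sum_(b < n) (e (v b) y && ((b < h) == false)) <= n - h.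
    have <- : \sum_(b < n) (h <= b < n) = n - h by rewrite sum_interval; lia.
    by apply: leq_sum => b _; have := ltn_ord b; lia.
  (* The blue degree of [v a] is [n - h - 1 + (a - h) + d a]. It exceeds [n - h] unless [a = h] and
     [d a = 1]; there [y] has to miss a vertex of the blue half. *)
  have [E|E] := eqVneq a h; last lia.
  have [da1|] := leqP (d a) 1; last lia.
  have [b hb bY] : exists2 b, h <= b < n & ~~ e (v b) y by apply: dy; rewrite -?E.
  suff : \sum_(b < n) (e (v b) y && ((b < h) == false)) + 1 <= n - h by lia.
  have <- : \sum_(b < n) (h <= b < n) = n - h by rewrite sum_interval; lia.
  have <- : \sum_(i < n) (val i == b) = 1 by rewrite sum_pred1; lia.
  rewrite -big_split /=; apply: leq_sum => i _; have := ltn_ord i.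
  by have [->|] := eqVneq (val i) b; [rewrite (negPf bY) | ]; lia.
Qed.

(** Only the Y-edges at [v 0] are blue. From position 2 on, sorting keeps the red degrees distinct.
    Vertices with Y-neighbours come so early that [p + 2 - d 1] and [p.*2 - 2 + d 0] are not among
    them, so these two have the red degrees that [sparse_red] is designed for. *)
Lemma sparse_colourable p : p.+1.*2 <= n <= p.+1.*2.+1 -> 4 <= p ->
  0 < d 1 <= d 0 -> d 1 + d 0 <= p ->
  (forall a, 2 <= a < n -> 0 < d a -> a + d 1 <= p) ->
  (forall a b, a <= b < n -> d b <= d a) ->
  irr_colourable e 2.
Proof.
move=> hn p4 d10 hd da_small d_sorted.
have row a : 2 <= a -> sparse_row p (d 0) a = p.*2 + 2 - a by case: a => [|[|a]].
have row1 : sparse_row p (d 0) 1 = p by [].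
have row0 : sparse_row p (d 0) 0 = if d 0 <= 2 then 4 else 2 by [].
apply: (two_colourable (R := fun a b => sparse_red p (d 1) (d 0) (minn a b) (maxn a b))
  (B := fun a => a != 0) (r := sparse_row p (d 0))).
- by move=> a b; rewrite minnC maxnC.
- by move=> a an; apply: row_sum_sparse.
- move=> a b ab bn; rewrite (minn_idPl (ltnW ab)) (maxn_idPr (ltnW ab)) -/(d a) -/(d b).
  have b0 : b != 0 by lia.
  rewrite b0 mul1n; case: a ab => [|[|a]] ab /=.
  + have := sparse_red0 hn p4 d10 hd b; case: (sparse_red _ _ _ _ _) => // + _.
    have [->|b1] := eqVneq b 1; first by lia.
    rewrite row0 (row b); last by lia.
    by case: ifP; have := da_small b; lia.
  + have := sparse_red1 hn p4 d10 hd b; case: (sparse_red _ _ _ _ _) => // + _.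
    rewrite (row b); last by lia.
    by have := da_small b; rewrite /sparse_row /=; lia.
  + move=> _; rewrite !row //; last by lia.
    by have := d_sorted a.+2 b; lia.
- move=> a b ab bn; rewrite (minn_idPl (ltnW ab)) (maxn_idPr (ltnW ab)) -/(d a) -/(d b).
  have b0 : b != 0 by lia.
  rewrite b0 mul0n; case: a ab => [|[|a]] ab /=.
  + have := sparse_red0 hn p4 d10 hd b; case: (sparse_red _ _ _ _ _) => // + _.
    have [->|b1] := eqVneq b 1; first by rewrite row0 row1; case: ifP; lia.
    rewrite row0 (row b); last by lia.
    by case: ifP; have := da_small b; lia.
  + have := sparse_red1 hn p4 d10 hd b; case: (sparse_red _ _ _ _ _) => // + _.
    rewrite (row b); last by lia.
    by rewrite /sparse_row /=; lia.
  + by move=> _; rewrite !row //; lia.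
- move=> a y an yX ay; rewrite -/(d a).
  have da : 0 < d a := dY_gt0 yX ay.
  have [a0|a0] := eqVneq a 0.
    subst a => /=.
    have : \sum_(b < n) (e (v b) y && ((val b != 0) == false)) <= \sum_(b < n) (val b == 0).
      by apply: leq_sum => b _; case: (e _ _) => //=; lia.
    by rewrite sum_pred1 /sparse_row /=; case: ifP; lia.
  (* The possible red neighbours of [y] lie among positions 1, ..., [p], while [v a] has red degree
     above [p]. *)
  have : \sum_(b < n) (e (v b) y && ((val b != 0) == true)) <= \sum_(b < n) (1 <= b < p.+1).
    apply: leq_sum => b _; case: (boolP (e _ _)) => //= eby.
    have db : 0 < d b := dY_gt0 yX eby.
    have := da_small b; have := ltn_ord b; lia.
  rewrite sum_interval /=.
  have [->|a1] := eqVneq a 1; first by rewrite /sparse_row /=; lia.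
  by have := da_small a; rewrite row; lia.
Qed.

End Split.

(* The vertices of positive weight taken from [ps] sit at the partial sums of
   their weights, so that each takes the value of the next one's position;
   the last one overshoots [m], and weightless vertices fill the gaps. *)
Lemma chain_arrangement (d : nat -> nat) (ps zs : seq nat) m :
  0 < m -> m <= \sum_(x <- ps) d x -> m.-1 <= size zs ->
  all (fun x => 0 < d x) ps -> all (fun x => d x == 0) zs ->
  exists (s : seq nat) j (zs' : seq nat), [/\ perm_eq (ps ++ zs) (s ++ zs' ++ drop j ps), size s = m,
    0 < d (nth 0 s 0), all (fun x => d x == 0) zs' &
    forall i j, i < j < m -> i + d (nth 0 s i) != j + d (nth 0 s j)].
Proof.
elim: ps zs m => [|a ps IH] zs m m0; first by rewrite big_nil; lia.
rewrite big_cons /= => sm szs /andP [a0 psP] zs0.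
have zs0P x : x \in zs -> d x = 0 by move=> xz; apply/eqP/(allP zs0).
have zs0n i : d (nth 0 zs i) = 0 \/ size zs <= i.
  by case: (ltnP i (size zs)) => iz; [left; apply/zs0P/mem_nth | right].
have [ma|am] := leqP m (d a).
  exists (a :: take m.-1 zs), 1, (drop m.-1 zs); split=> //=.
  - rewrite drop0 perm_cons perm_catC catA perm_cat2r cat_take_drop //.
  - by rewrite size_takel //; lia.
  - by apply/allP => x /mem_drop /(allP zs0).
  - have tk i : i < m.-1 -> d (nth 0 (take m.-1 zs) i) = 0.
      by move=> im; rewrite nth_take //; case: (zs0n i) => //; lia.
    case=> [|i] [|j] //= ij; rewrite ?tk; lia.
have [|||||s [j [zs' [pE ss s0 zs'0 sd]]]] := IH (drop (d a).-1 zs) (m - d a).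
- by lia.
- by lia.
- by rewrite size_drop; lia.
- by [].
- by apply/allP => x /mem_drop /(allP zs0).
set t := take (d a).-1 zs.
have st : size t = (d a).-1 by rewrite size_takel //; lia.
have tk i : i < (d a).-1 -> d (nth 0 t i) = 0.
  by move=> im; rewrite nth_take //; case: (zs0n i) => //; lia.
exists (a :: t ++ s), j.+1, zs'; split=> //=.
- rewrite perm_cons -(cat_take_drop (d a).-1 zs) -/t -catA.
  by rewrite perm_catCA perm_cat2l.
- by rewrite size_cat st ss; lia.
- have val i : 0 < i < m -> i + d (nth 0 (t ++ s) i.-1) =
      if i < d a then i else d a + (i - d a + d (nth 0 s (i - d a))).
    move=> im; rewrite nth_cat st; case: (ltnP i.-1 (d a).-1) => ia.
      by rewrite tk // ifT //; lia.
    by rewrite (_ : i.-1 - _ = i - d a) ?ifF; lia.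
  move=> [|i] k ik //=; last first.
    case: k ik => [|k] ik; first lia.
    have /= -> := val i.+1; last lia.
    have /= -> := val k.+1; last lia.
    have := sd (i.+1 - d a) (k.+1 - d a).
    by case: (ltnP i.+1 (d a)) => ia; case: (ltnP k.+1 (d a)) => ka; lia.
  case: k ik => [|k] ik; first lia.
  have /= -> := val k.+1; last lia.
  case: (ltnP k.+1 (d a)) => ka; first lia.
  (* Position [d a] holds the first entry of [s], whose positive weight moves it off the value [d a]
     taken by position 0. *)
  have [->|] := eqVneq (k.+1 - d a) 0; first by lia.
  by lia.
Qed.

(** * Orderings of the clique for the half-graph colouring *)

Section Arrangements.
Variables (T : finType) (e : rel T) (X : {set T}) (n : nat) (v : nat -> T).
Hypotheses (e_sym : symmetric e) (e_irr : irreflexive e).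
Hypotheses (hK : is_clique e X) (hY : is_stable e (~: X)).
Hypothesis v_inj : {in [pred i | i < n] &, injective v}.
Hypothesis hX : X = [set v (val i) | i : 'I_n].

Let d i := dY e X (v i).

Hypothesis d_sorted : forall a b, a <= b < n -> d b <= d a.

Lemma halfgraph_colourable_arrange (f : nat -> nat) h :
  h.*2 <= n <= h.*2.+1 -> 1 < h ->
  (forall a, a < n -> f a < n) -> {in [pred i | i < n] &, injective f} ->
  (forall a b, a < b < h -> d (f a) + b != d (f b) + a) ->
  0 < d (f h.-1) ->
  (forall a b, h <= a < b -> b < n -> a + d (f a) != b + d (f b)) ->
  (forall y, y \notin X -> e (v (f h)) y -> d (f h) <= 1 ->
     exists2 b, h <= b < n & ~~ e (v (f b)) y) ->
  irr_colourable e 2.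
Proof.
move=> hn h1 fn f_inj; apply: (@halfgraph_colourable _ e X n (v \o f)) => //.
  move=> a b an bn /= vab; apply: f_inj => //; apply: v_inj vab; rewrite inE; exact: fn.
pose g (i : 'I_n) := Ordinal (fn i (ltn_ord i)).
have g_inj : injective g.
  by move=> i j [] fij; apply: val_inj; apply: f_inj fij; rewrite inE.
apply/setP => x; rewrite hX; apply/imsetP/imsetP => -[i _ ->].
  have /(congr1 val) /= fi := f_invF g_inj i.
  by exists (invF g_inj i); rewrite //= fi.
by exists (g i).
Qed.

(* Moving [v m] to the end of the blue half makes room for a vertex that
   a given Y-vertex misses. *)
Lemma many_positive_colourable h : h.*2 <= n <= h.*2.+1 -> 1 < h -> 0 < d h.-1 ->
  (forall y, y \notin X -> exists2 x, x \in X & ~~ e x y) ->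
  irr_colourable e 2.
Proof.
move=> hn h1 dh miss.
(* [m = h] keeps both halves. For [m < h], [v h] takes the last red position, hence the condition on
   [d h]. *)
suff arr m : m <= h -> (m < h -> 0 < d h) ->
    (forall y, y \notin X -> e (v n.-1) y -> d n.-1 <= 1 ->
      exists2 b, (b == m) || (h < b < n) & ~~ e (v b) y) -> irr_colourable e 2.
  have [/existsP [y /and3P [yX ny d1]]|/existsPn nn] :=
      boolP [exists y, [&& y \notin X, e (v n.-1) y & d n.-1 <= 1]]; last first.
    by apply: (arr h) => // [|y yX ny d1]; [lia | have := nn y; rewrite yX ny d1].
  (* A vertex [v i] missed by the only Y-neighbour of [v n.-1] is moved to the blue half if [i < h],
     and lies there already otherwise. *)
  have [x xX xy] := miss y yX.
  have [i ni xi] : exists2 i, i < n & x = v i.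
    by move: xX; rewrite hX => /imsetP [i _ ->]; exists i.
  apply: (arr (minn i h)); first by lia.
    by move=> _; have := dY_gt0 yX ny; have := d_sorted (a := h) (b := n.-1); rewrite -/(d _); lia.
  move=> z zX nz _; rewrite (dY1_uniq zX yX d1 nz ny).
  by exists i; [lia | rewrite -xi].
move=> mh dm missm.
(* The blue half is listed backwards: Y-degrees do not decrease along it, and [v n.-1] sits at the
   critical position [h]. *)
pose f a := if a < m then a else if a < h then a.+1 else if a == n.-1 then m else n.-1 - (a - h).
have fE a : f a = if a < m then a else if a < h then a.+1 else if a == n.-1 then m else n.-1 - (a - h) by [].
have f_lo a : a < h -> f a = a + (m <= a) by move=> ah; rewrite fE ah; case: ltnP; lia.
have f_hi a : h <= a -> a < n.-1 -> f a = n.-1 - (a - h).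
  by move=> ha an; rewrite fE !ifF //; lia.
have f_last : f n.-1 = m by rewrite fE eqxx !ifF //; lia.
have cases a : a < n -> [\/ a < h, h <= a < n.-1 | a = n.-1].
  by move=> an; case: (ltnP a h); case: (ltnP a n.-1) => ? ?;
    [constructor 1 | constructor 1 | constructor 2 | constructor 3]; lia.
apply: (halfgraph_colourable_arrange (f := f) hn h1).
- by move=> a /cases [ah|/andP [ah an]|->]; rewrite ?f_last ?(f_lo _ ah) ?(f_hi _ ah an); lia.
- move=> a b; rewrite !inE => an bn.
  by case/cases: (an) => [ah|/andP [ah an1]|->]; case/cases: (bn) => [bh|/andP [bh bn1]|->];
    rewrite ?f_last ?(f_lo _ ah) ?(f_lo _ bh) ?(f_hi _ ah an1) ?(f_hi _ bh bn1); lia.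
- move=> a b ab; rewrite !f_lo; try lia.
  by have := d_sorted (a := a + (m <= a)) (b := b + (m <= b)); lia.
- rewrite f_lo; last lia.
  have [->|mh1] := eqVneq m h; first by rewrite (_ : _ + _ = h.-1) //; lia.
  by rewrite (_ : _ + _ = h); [apply: dm; lia | lia].
- move=> a b ab bn; have -> : f a = n.-1 - (a - h) by apply: f_hi; lia.
  have [->|bn1] := eqVneq b n.-1.
    by rewrite f_last; have := d_sorted (a := m) (b := n.-1 - (a - h)); lia.
  have -> : f b = n.-1 - (b - h) by apply: f_hi; lia.
  by have := d_sorted (a := n.-1 - (b - h)) (b := n.-1 - (a - h)); lia.
- have -> : f h = n.-1 by rewrite f_hi; lia.
  move=> y yX ny d1; have [b hb by_] := missm y yX ny d1.
  have [E|bm] := eqVneq b m; first by exists n.-1; [lia | rewrite f_last -E].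
  by exists (n.-1 - b + h); [lia | rewrite f_hi; try lia; rewrite (_ : _ - _ = b) //; lia].
Qed.

Lemma large_sum_colourable h : h.*2 <= n <= h.*2.+1 -> 1 < h -> d h.-1 = 0 ->
  h <= \sum_(i < n) d i -> irr_colourable e 2.
Proof.
move=> hn h1 dh dsum.
pose k := find (fun i => d i == 0) (iota 0 n).
have dk i : i < k -> 0 < d i.
  move=> ik; have kn : k <= n by rewrite -[X in _ <= X](size_iota 0 n) find_size.
  have := before_find 0 ik; rewrite nth_iota; last lia.
  by rewrite /= add0n; lia.
have hk : k <= h.-1 by rewrite leqNgt; apply/negP => /dk; rewrite dh.
have kn : k < n by lia.
have dk0 i : k <= i < n -> d i = 0.
  move=> ik; have kz : d k == 0.
    have := @nth_find _ 0 (fun i => d i == 0) (iota 0 n); rewrite -/k nth_iota //=; apply.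
    by rewrite has_find size_iota.
  by have := d_sorted (a := k) (b := i) ik; lia.
have [|||||s [j [zs [sE ss s0 zs0 sd]]]] := @chain_arrangement d (iota 0 k) (iota k (n - k)) h.
- by lia.
- apply: leq_trans dsum _; rewrite -(big_mkord xpredT d) /index_iota subn0.
  rewrite -{1}(subnKC (ltnW kn)) iotaD big_cat /= [X in _ + X]big1_seq ?addn0 // => i.
  by rewrite /= mem_iota add0n => ik; apply: dk0; lia.
- by rewrite size_iota; lia.
- by apply/allP => i; rewrite mem_iota => ik; apply: dk; lia.
- by apply/allP => i; rewrite mem_iota => ik; rewrite dk0 //; lia.
move: sE; rewrite -iotaD subnKC ?(ltnW kn) // drop_iota add0n => sE.
(* Red degrees inside X decrease along the red half, so the chain is reversed; its first entry, of
   positive weight, lands at [h.-1]. The blue half starts with weightless vertices, leaving position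
   [h] without Y-neighbours, and ends with the leftover positive ones by non-decreasing Y-degree. *)
pose us : seq nat := rev s ++ zs ++ rev (iota j (k - j)).
pose f := nth 0 us.
have fE : perm_eq us (iota 0 n).
  rewrite perm_sym (perm_trans sE) // perm_cat // ?perm_cat //.
    by rewrite perm_sym perm_rev.
  by rewrite perm_sym perm_rev.
have fsize : size us = n by rewrite (perm_size fE) size_iota.
have zsize : size zs = n - h - (k - j).
  by move: fsize; rewrite !size_cat !size_rev size_iota ss; lia.
have f_lo a : a < h -> f a = nth 0 s (h.-1 - a).
  move=> ah; rewrite /f /us nth_cat size_rev ss ah nth_rev ss //.
  by congr (nth _ _ _); lia.
have f_mid a : h <= a < h + size zs -> d (f a) = 0.
  move=> ha; rewrite /f /us nth_cat size_rev ss ifF; last lia.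
  rewrite nth_cat ifT; last lia.
  have az : a - h < size zs by lia.
  by apply/eqP/(allP zs0)/mem_nth.
have f_hi a : h + size zs <= a < n -> f a = k.-1 - (a - h - size zs).
  move=> ha; rewrite /f /us nth_cat size_rev ss ifF; last lia.
  rewrite nth_cat ifF; last lia.
  by rewrite nth_rev size_iota ?nth_iota; lia.
apply: (halfgraph_colourable_arrange (f := f) hn h1).
- move=> a an; have : f a \in iota 0 n.
    by rewrite -(perm_mem fE) mem_nth // fsize.
  by rewrite mem_iota.
- move=> a b an bn /eqP; rewrite nth_uniq ?fsize //; first by move/eqP.
  by rewrite (perm_uniq fE) iota_uniq.
- move=> a b ab; rewrite !f_lo; try lia.
  by have := sd (h.-1 - b) (h.-1 - a); lia.
- by rewrite f_lo ?subnn //; lia.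
- move=> a b ab bn.
  have [bz|bz] := ltnP b (h + size zs); first by rewrite !f_mid; lia.
  have [az|az] := ltnP a (h + size zs); first by rewrite (f_mid a); lia.
  rewrite !f_hi; try lia.
  by have := d_sorted (a := k.-1 - (b - h - size zs)) (b := k.-1 - (a - h - size zs)); lia.
- by move=> y yX /(dY_gt0 yX); rewrite -/(d (f h)) f_mid //; lia.
Qed.
End Arrangements.

(** * Split graphs *)

Lemma irr_colourable_add (T : finType) (e g : rel T) k : symmetric g ->
  (forall x y, e x y -> g x y ->
     #|[set z | e x z && g x z]| != #|[set z | e y z && g y z]|) ->
  irr_colourable (fun x y => e x y && ~~ g x y) k -> irr_colourable e k.+1.
Proof.
move=> gsym girr [c [csym cirr]].
pose c' x y := if g x y then ord_max else widen_ord (leqnSn k) (c x y).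
have degmax x : col_deg e c' ord_max x = #|[set z | e x z && g x z]|.
  apply: eq_card => z; rewrite !inE /c'; case: (g x z); rewrite ?eqxx //.
  by rewrite -(inj_eq val_inj) /= (ltn_eqF (ltn_ord _)).
have degin i x : col_deg e c' (widen_ord (leqnSn k) i) x
    = col_deg (fun x y => e x y && ~~ g x y) c i x.
  apply: eq_card => z; rewrite !inE /c'; case: (g x z); rewrite ?andbT ?andbF //=.
  by rewrite -(inj_eq val_inj) /= gtn_eqF ?andbF.
exists c'; split=> x y xy.
  by rewrite /c' gsym; case: ifP => // gyx; rewrite csym // xy gsym gyx.
rewrite [c' x y]/c'; case: ifP => gxy; first by rewrite !degmax girr.
by rewrite !degin cirr // xy gxy.
Qed.

(** The vertex [x0] rules out zero colours, since a colouring maps into ['I_k] even when there are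
    no edges. Testing whether the whole graph is locally irregular then decides between 1 and 2. *)
Lemma chi_irr_le2 (T : finType) (e : rel T) (x0 : T) :
  irr_colourable e 2 -> exists k, is_chi_irr e k /\ k <= 2.
Proof.
move=> col2; have no0 : ~ irr_colourable e 0 by case=> c _; case: (c x0 x0).
pose deg x := #|[set y | e x y]|.
have degE (c : T -> T -> 'I_1) i x : col_deg e c i x = deg x.
  by apply: eq_card => y; rewrite !inE !ord1 eqxx andbT.
have [/forallP irr|nirr] := boolP [forall x, forall y, e x y ==> (deg x != deg y)].
  exists 1; split=> //; split=> [|[|j] //].
  exists (fun _ _ => ord0); split=> // x y xy; rewrite !degE.
  by move/forallP/(_ y)/implyP: (irr x); apply.
exists 2; split=> //; split=> // -[|[|j]] // [c [_ cirr]].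
case/negP: nirr; apply/forallP => x; apply/forallP => y; apply/implyP => xy.
by have := cirr x y xy; rewrite !degE.
Qed.

Section SplitGraph.
Variables (T : finType) (e : rel T) (X : {set T}) (n : nat) (v : nat -> T).
Hypotheses (e_sym : symmetric e) (e_irr : irreflexive e).
Hypotheses (hXmax : is_maximal_clique e X) (hY : is_stable e (~: X)).
Hypothesis v_inj : {in [pred i | i < n] &, injective v}.
Hypothesis hX : X = [set v (val i) | i : 'I_n].

Let d i := dY e X (v i).

Hypothesis d_sorted : forall i j, i <= j -> j < n -> d j <= d i.
Hypothesis hn : 10 <= n.

Let hK : is_clique e X. Proof. by case: hXmax. Qed.

Lemma maximal_clique_miss y : y \notin X -> exists2 x, x \in X & ~~ e x y.
Proof.
move=> yX; have [/existsP [x /andP []]|/existsPn all_adj] :=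
  boolP [exists x, (x \in X) && ~~ e x y]; first by exists x.
have adj x : x \in X -> e x y by move=> xX; have := all_adj x; rewrite xX negbK.
have [_ maxX] := hXmax; suff yXK : is_clique e (y |: X).
  by have /setP /(_ y) := maxX _ yXK (subsetUr _ _); rewrite !inE eqxx (negPf yX).
move=> a b; rewrite !inE => /orP [/eqP ->|aX] /orP [/eqP ->|bX] ab.
- by rewrite eqxx in ab.
- by rewrite e_sym adj.
- exact: adj.
- exact: hK.
Qed.

Lemma two_colourable_of_degrees : n./2 <= d 0 \/ 1 <= d 1 -> irr_colourable e 2.
Proof.
move=> hd; have hh : n./2.*2 <= n <= n./2.*2.+1 by lia.
have sorted a b : a <= b < n -> d b <= d a by case/andP; apply: d_sorted.
have [d0|dh] := posnP (d n./2.-1); last first.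
  apply: (many_positive_colourable e_sym e_irr hK hY v_inj hX sorted hh) => //; first lia.
  exact: maximal_clique_miss.
have [dsum|dsum] := leqP n./2 (\sum_(i < n) d i).
  by apply: (large_sum_colourable e_sym e_irr hK hY v_inj hX sorted hh) => //; lia.
(* By sorting, each of the vertices 2, ..., [a] adds at least 1 to the sum; a small sum thus
   confines the Y-neighbours to early positions. *)
have bound a : 0 < a < n -> 0 < d a -> a.-1 + d 0 + d 1 <= \sum_(i < n) d i.
  move=> an da.
  have -> : a.-1 + d 0 + d 1 =
      \sum_(i < n) ((2 <= i < a.+1) + d 0 * (val i == 0) + d 1 * (val i == 1)).
    by rewrite !big_split /= !sum_pred1M sum_interval; lia.
  apply: leq_sum => i _ /=; have := ltn_ord i.
  case: (nat_of_ord i) => [|[|k]] kn; rewrite /= ?muln1 ?muln0 ?addn0 ?add0n //.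
  by have := sorted k.+2 a; lia.
have d01 : d 1 <= d 0 by apply: sorted; lia.
have d1 : 0 < d 1.
  case: hd => // hd0; have : \sum_(i < n) d 0 * (val i == 0) <= \sum_(i < n) d i.
    by apply: leq_sum => i _ /=; case: (nat_of_ord i) => [|k]; rewrite ?muln1 ?muln0.
  by rewrite sum_pred1M; lia.
have b1 := bound 1.
(* With [p.+1 = n./2], a sum below [n./2] is at most [p], and [10 <= n] gives [4 <= p]. *)
apply: (sparse_colourable e_sym e_irr hK hY v_inj hX (p := n./2.-1)).
- by lia.
- by lia.
- by rewrite d1; apply: sorted; lia.
- by rewrite -/(d 0) -/(d 1); lia.
- move=> a an da; have an0 : 0 < a < n by lia.
  by have := bound a an0 da; rewrite -/(d 1); lia.
- exact: sorted.
Qed.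

(** The obstruction applies with [m = n.-1] and with [p] and [q] the numbers of red and blue Y-edges
    at [v 0], which add up to [d 0]. *)
Lemma not_two_colourable : d 0 < n./2 -> d 1 = 0 -> ~ irr_colourable e 2.
Proof.
move=> d0 d1 [c [csym cirr]].
have dz a : 0 < a < n -> d a = 0.
  by move=> /andP [a0 an]; have := d_sorted a0 an; lia.
pose out a (i : 'I_2) := #|[set y | e (v a) y && (c (v a) y == i)] :\: X|.
have out0 a i : 0 < a < n -> out a i = 0.
  move=> an; apply/eqP; rewrite -leqn0 -(dz a an); apply: subset_leq_card.
  by apply/subsetP => y; rewrite !inE => /and3P [-> ->].
pose R a b := c (v a) (v b) == ord0.
have col1 (i : 'I_2) : (i == ord_max) = ~~ (i == ord0) by case: i => [[|[|]]].
have nE : n = n.-1.+1 by lia.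
have deg0 a : a < n -> col_deg e c ord0 (v a) = row_sum n R a + out a ord0.
  by move=> an; rewrite (col_deg_inX e_irr hK v_inj hX).
have deg1 a : a < n -> col_deg e c ord_max (v a) = n.-1 - row_sum n R a + out a ord_max.
  move=> an; rewrite (col_deg_inX e_irr hK v_inj hX) //; congr (_ + _).
  rewrite -row_sum_compl //; apply: eq_bigr => b _; by rewrite col1.
have irr a b : a < n -> b < n -> a != b ->
    if R a b then row_sum n R a + out a ord0 != row_sum n R b + out b ord0
    else n.-1 - row_sum n R a + out a ord_max != n.-1 - row_sum n R b + out b ord_max.
  move=> an bn ab; have := cirr (v a) (v b); rewrite (v_adj e_irr hK v_inj hX) // => /(_ ab).
  rewrite /R; case: (eqVneq (c (v a) (v b)) ord0) => [->|cn]; first by rewrite !deg0.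
  by have /eqP -> : c (v a) (v b) == ord_max; [rewrite col1 | rewrite !deg1].
apply: (@no_two_colouring n.-1 R (out 0 ord0) (out 0 ord_max)); rewrite -?nE.
- by lia.
- move=> a b an bn ab; rewrite /R csym // (v_adj e_irr hK v_inj hX) //.
- move=> a b ab bn; have := irr a b; rewrite !out0; try lia.
  by case: ifP => _; lia.
- move=> a an Ra; have := irr 0 a; rewrite Ra (out0 a) //; lia.
- move=> a an Ra; have := irr 0 a; rewrite (negPf Ra) (out0 a) //; lia.
- apply: leq_ltn_trans d0; rewrite /out -cardsUI [X in _ + X]eq_card0 ?addn0.
    apply: subset_leq_card; apply/subsetP => y; rewrite !inE.
    by case: (y \in X); case: (e _ _).
  by move=> y; rewrite !inE col1; case: (_ == ord0); rewrite ?andbF.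
Qed.

(* A third colour takes a star at [v 0] that covers its pendant edges and two
   edges of the clique; [v 0] then joins Y and has many neighbours left. *)
Lemma three_colourable : d 1 = 0 -> irr_colourable e 3.
Proof.
move=> d1.
have dz a y : 0 < a < n -> y \notin X -> e (v a) y = false.
  move=> /andP [a0 an] yX; apply/negP => /(dY_gt0 yX).
  by have := d_sorted a0 an; rewrite -/(d a); lia.
have vv := v_eq v_inj; have vX := v_in hX.
pose leaf x := [|| x \notin X, x == v n.-1 | x == v n.-2].
pose g x y := (x == v 0) && leaf y || (y == v 0) && leaf x.
have leaf0 : leaf (v 0) = false by rewrite /leaf vX ?vv; lia.
have gsym : symmetric g by move=> x y; rewrite /g orbC.
have g0 y : g (v 0) y = leaf y by rewrite /g eqxx leaf0 andbF orbF.
have gn0 x y : x != v 0 -> g x y -> y = v 0.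
  by move=> /negPf x0; rewrite /g x0 /= => /andP [/eqP].
(* The two clique edges give the centre degree at least 2 even without Y-neighbours; all other
   vertices have degree at most 1 in the star. *)
have star0 : 2 <= #|[set z | e (v 0) z && g (v 0) z]|.
  have <- : #|[set v n.-1; v n.-2]| = 2 by rewrite cards2 vv; lia.
  apply/subset_leq_card/subsetP => z; rewrite !inE g0 /leaf => /orP [] /eqP ->;
    by rewrite eqxx ?orbT (v_adj e_irr hK v_inj hX); lia.
have star1 x : x != v 0 -> #|[set z | e x z && g x z]| <= 1.
  move=> x0; rewrite -(cards1 (v 0)); apply/subset_leq_card/subsetP => z.
  by rewrite !inE => /andP [_ /(gn0 _ _ x0) ->].
apply: (irr_colourable_add gsym).
  move=> x y xy gxy; have [x0|x0] := eqVneq x (v 0).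
    have y0 : y != v 0 by apply: contraL xy => /eqP ->; rewrite x0 e_irr.
    by rewrite x0; have := star1 y y0; lia.
  by rewrite (gn0 x y x0 gxy); have := star1 x x0; lia.
(* The rest is a split graph with clique [X :\ v 0] and [v 0] on the stable side, adjacent to all
   clique vertices but the last two. The new Y-degrees are therefore 1, ..., 1, 0, 0. *)
set e' := fun x y => _; pose X' := X :\ v 0; pose v' i := v i.+1.
have out' y : y \notin X' -> y = v 0 \/ y \notin X.
  by rewrite !inE negb_and negbK => /orP [/eqP|]; [left|right].
have e'sym : symmetric e' by move=> x y; rewrite /e' e_sym gsym.
have e'irr : irreflexive e' by move=> x; rewrite /e' e_irr.
have hK' : is_clique e' X'.
  move=> x y; rewrite !inE => /andP [x0 xX] /andP [y0 yX] xy.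
  by rewrite /e' hK //=; apply/negP => /(gn0 _ _ x0) E; rewrite E eqxx in y0.
have hY' : is_stable e' (~: X').
  move=> x y; rewrite !in_setC => /out' [->|xX] /out' [->|yX]; rewrite /e'.
  - by rewrite e_irr.
  - by rewrite g0 /leaf yX andbF.
  - by rewrite gsym g0 /leaf xX andbF.
  - by rewrite (negPf (hY _ _)) // in_setC.
have v'_inj : {in [pred i | i < n.-1] &, injective v'}.
  by move=> i j; rewrite !inE => ni nj /eqP; rewrite vv; [move/eqP => []|lia|lia].
have hX' : X' = [set v' (val i) | i : 'I_n.-1].
  apply/setP => x; rewrite !inE; apply/andP/imsetP => [[x0]|[i _ ->]].
    rewrite hX => /imsetP [[[|i] ni] _ xi]; first by rewrite xi eqxx in x0.
    have ni' : i < n.-1 by lia.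
    by exists (Ordinal ni').
  have ni : (nat_of_ord i).+1 < n by have := ltn_ord i; lia.
  by split; [rewrite vv //; lia | apply: vX].
have leaf' i : i < n.-1 -> leaf (v' i) = (n.-1.-2 <= i).
  by move=> ni; rewrite /leaf /v' vX ?vv; lia.
have d'E i : i < n.-1 -> dY e' X' (v' i) = (i < n.-1.-2).
  move=> ni; rewrite /dY.
  have -> : [set y | e' (v' i) y] :&: ~: X' = if i < n.-1.-2 then [set v 0] else set0.
    apply/setP => y; rewrite 3!inE; apply/andP/idP.
      case=> /andP [ey ng] /out' [y0|yX]; last by rewrite dz // in ey; lia.
      by move: ng; rewrite y0 gsym g0 leaf' // -ltnNge => ->; rewrite inE.
    case: ifP => ni2; rewrite !inE // => /eqP ->; rewrite eqxx /=; split=> //.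
    by rewrite /e' gsym g0 leaf' // -ltnNge ni2 (v_adj e_irr hK v_inj hX); lia.
  by case: ifP; rewrite ?cards1 ?cards0.
apply: (many_positive_colourable e'sym e'irr hK' hY' v'_inj hX' _ (h := n.-1./2)).
- by move=> a b ab; rewrite !d'E; lia.
- by lia.
- by lia.
- by rewrite d'E; lia.
move=> y /out' [->|yX].
  exists (v n.-1); first by rewrite !inE vX ?vv; lia.
  by rewrite /e' gsym g0 /leaf eqxx orbT andbF.
exists (v 1); first by rewrite !inE vX ?vv; lia.
by rewrite /e' dz //; lia.
Qed.
End SplitGraph.

Theorem theorem1p3 (T : finType) (e : rel T)
  (e_sym : symmetric e) (e_irr : irreflexive e)
  (X : {set T})
  (hXmax : is_maximal_clique e X) (hY : is_stable e (~: X))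
  (n : nat) (v : nat -> T)
  (hv_inj : {in [pred i | i < n] &, injective v})
  (hX : X = [set v (nat_of_ord i) | i : 'I_n])
  (hsorted : forall i j, i <= j -> j < n -> dY e X (v j) <= dY e X (v i))
  (hn : 10 <= n) :
  ((exists k, is_chi_irr e k /\ k <= 2) <->
     (n %/ 2 <= dY e X (v 0) \/ 1 <= dY e X (v 1)))
  /\
  (is_chi_irr e 3 <->
     (dY e X (v 0) < n %/ 2 /\ dY e X (v 1) = 0)).
Proof.
have two := two_colourable_of_degrees e_sym e_irr hXmax hY hv_inj hX hsorted hn.
have not2 := not_two_colourable e_irr hXmax hv_inj hX hsorted hn.
have three := three_colourable e_sym e_irr hXmax hY hv_inj hX hsorted hn.
rewrite divn2; split; split.
- move=> [k [[colk _] k2]]; have col2 := irr_colourable_leq k2 colk.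
  have [|d0] := leqP n./2 (dY e X (v 0)); first by left.
  by right; rewrite lt0n; apply/eqP => d1; apply: not2.
- by move=> /two; apply: chi_irr_le2 (v 0).
- move=> [_ min3]; have no2 : ~ irr_colourable e 2 by move/min3.
  split; last by apply/eqP; rewrite -leqn0 leqNgt; apply/negP => d1; apply/no2/two; right.
  by rewrite ltnNge; apply/negP => d0; apply/no2/two; left.
- move=> [d0 d1]; split=> [|j colj]; first exact: three.
  rewrite leqNgt; apply/negP => j2; apply: (not2 d0 d1).
  exact: irr_colourable_leq colj.
Qed.
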